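(* Let $\Omega^\delta_\diamondsuit$ be a simply connected discrete domain on a $\delta$-isoradial graph, let $L^\delta_{\Gamma^*}$ be a ''white'' boundary arc of it, let $u_{\mathrm{int}}w_1w_2$ be a boundary half-rhombus touching $L^\delta_{\Gamma^*}$ (with $[w_1w_2]\subset L^\delta_{\Gamma^*}$, $w_{1,2}\in\Gamma^*$, $u_{\mathrm{int}}\in\Gamma$ an inner vertex), and let $\zeta=\frac12(w_1+w_2)$. Suppose that $F^\delta$ is s-holomorphic in $\Omega^\delta_\diamondsuit$ and $F^\delta(\zeta)\parallel(w_2-w_1)^{-\frac12}$, and let $H^\delta=\mathrm{Im}\int^\delta(F^\delta(z))^2d^\delta z$, with restrictions $H^\delta_\Gamma$, $H^\delta_{\Gamma^*}$ to black and white vertices. Modify the lattice at $\zeta$ by the boundary modification, i.e. replace the half-rhombus $u_{\mathrm{int}}w_1w_2$ by two rhombi $u_{\mathrm{int}}w_1\widetilde u_1\widetilde w$ and $u_{\mathrm{int}}\widetilde w\,\widetilde u_2w_2$ with half-angles $\frac12\theta$ at $u_{\mathrm{int}}$, where $\theta$ is the half-angle at $u_{\mathrm{int}}$ of the original rhombus. Then, if we set $$H^\delta_\Gamma(\widetilde u_2)=H^\delta_\Gamma(\widetilde u_1):=H^\delta_{\Gamma^*}(w_2)=H^\delta_{\Gamma^*}(w_1),$$ the function $H^\delta_\Gamma$ remains subharmonic at $u_{\mathrm{int}}$, i.e. its discrete Laplacian at $u_{\mathrm{int}}$ on the modified lattice is nonnegative.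
   Context: **Lattice.** Let $\delta>0$. A planar graph $\Gamma$ embedded in $\mathbb C$ is $\delta$-isoradial if each face is inscribed in a circle of radius $\delta$; the circle centers are assumed to lie inside the faces and are the vertices of the dual graph $\Gamma^*$. Vertices of $\Gamma$ are black, of $\Gamma^*$ white. $\Lambda=\Gamma\cup\Gamma^*$, with edges $[uw]$ joining $u\in\Gamma$ to the center $w\in\Gamma^*$ of an incident face; the faces of $\Lambda$ are rhombi with side $\delta$, and $\diamondsuit$ is the set of rhombi centers. All rhombi angles lie in $[\eta,\pi-\eta]$ for some fixed $\eta>0$. **Discrete domain.** $\Omega^\delta_\diamondsuit$ is the set of centers of the rhombi and boundary half-rhombi composing a simply connected polygonal domain $\Omega^\delta$. On a white boundary arc the boundary half-rhombi are triangles $u_{\mathrm{int}}w_1w_2$ with $[w_1w_2]\subset\partial\Omega^\delta$, center $\zeta=\frac12(w_1+w_2)$, where $w_2-w_1$ is the discrete tangent vector oriented counterclockwise (domain on the left). $z_0\sim z_1$ if the (half-)rhombi share an edge of $\Lambda$. $X\parallel Y$ means that $X$ is a real multiple of $Y$. **s-holomorphicity and $H$.** $\mathrm{Proj}[X;u]=\frac X2+\frac{\overline Xu^2}{2|u|^2}$. $F$ is s-holomorphic if $\mathrm{Proj}[F(z_0);[i(w-u)]^{-1/2}]=\mathrm{Proj}[F(z_1);[i(w-u)]^{-1/2}]$ for all $z_0\sim z_1$ with common edge $[uw]$, $u\in\Gamma$, $w\in\Gamma^*$. For such $F$, the function $H=\mathrm{Im}\int^\delta(F(z))^2d^\delta z$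 is well defined up to an additive constant on all vertices of the rhombi with centers in $\Omega^\delta_\diamondsuit$ by $H(u)-H(w)=2\delta|\mathrm{Proj}[F(z);[i(w-u)]^{-1/2}]|^2$ for every edge $[uw]$ of a rhombus with center $z\in\Omega^\delta_\diamondsuit$; it is subharmonic at inner vertices of $\Gamma$ on the original lattice. **Discrete Laplacian.** $[\Delta^\delta H](u)=\frac1{\mu(u)}\sum_{u_s\sim u}\tan\theta_s\,[H(u_s)-H(u)]$, $\mu(u)=\frac12\delta^2\sum_{u_s\sim u}\sin2\theta_s$, where $\theta_s$ is the half-angle at $u$ of the rhombus with diagonal $[uu_s]$. On the modified lattice, the term of the sum corresponding to the outer neighbor of $u_{\mathrm{int}}$ across $[w_1w_2]$ (with coefficient $\tan\theta$) is replaced by the two terms for $\widetilde u_1,\widetilde u_2$ with coefficients $\tan\frac\theta2$. *)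

(* Defs.v *)
From HB Require Import structures.
From mathcomp Require Import all_boot all_order all_algebra.
From mathcomp Require Import complex.
From mathcomp Require Import boolp classical_sets reals topology normedtype.
From mathcomp Require Import trigo.

Set Implicit Arguments.
Unset Strict Implicit.
Unset Printing Implicit Defensive.

Import Order.TTheory GRing.Theory Num.Theory.
Import numFieldTopology.Exports.

Local Open Scope classical_set_scope.
Local Open Scope ring_scope.

(* [R[i]] seen as an abstract numClosedFieldType: this is what carries the
   metric topology of the complex plane. *)
Definition cplane (R : realType) : numClosedFieldType := R[i].

(* The modulus, as an element of [R]; the ring norm takes values in [R[i]]. *)
Definition cabs (R : realType) (z : R[i]) : R := complex.Re `|z|.

Definition midpoint (R : realType) (a b : R[i]) : R[i] := (a + b) / 2%:R.

Definition segment (R : realType) (a b : R[i]) : set R[i] :=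
  [set p | exists2 t : R, 0 <= t <= 1 & p = a + (t%:C)%C * (b - a)].

Definition triangle (R : realType) (a b c : R[i]) : set R[i] :=
  [set p | exists x y z : R, [/\ 0 <= x, 0 <= y, 0 <= z, x + y + z = 1 &
     p = (x%:C)%C * a + (y%:C)%C * b + (z%:C)%C * c]].

(* Unoriented angle between two nonzero vectors, in [0, pi]. *)
Definition angle (R : realType) (a b : R[i]) : R :=
  acos (complex.Re (a * b^*) / (cabs a * cabs b)).

Definition half_angle (R : realType) (u a b : R[i]) : R :=
  angle (a - u) (b - u) / 2%:R.

Definition left_of (R : realType) (a b p : R[i]) : Prop :=
  0 < complex.Im ((b - a)^* * (p - a)).

Definition parallel (R : realType) (X Y : R[i]) : Prop :=
  exists t : R, X = (t%:C)%C * Y.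

Definition is_rhombus (R : realType) (delta : R) (a b c d : R[i]) : Prop :=
  [/\ cabs (b - a) = delta, cabs (d - a) = delta & a + c = b + d].

(* The points of [s] are listed counterclockwise, in one turn, around [u]. *)
Definition ccw_around (R : realType) (u : R[i]) (s : seq R[i]) : Prop :=
  exists r a : nat -> R,
  [/\ forall j, (j < size s)%N ->
        0 < r j /\ s`_j - u = ((r j * cos (a j)) +i* (r j * sin (a j)))%C,
      forall j k, (j < k < size s)%N -> a j < a k
    & forall j, (j < size s)%N -> a j < a 0%N + pi *+ 2].

(* A [delta]-isoradial graph, given with the rotation system of its embedding.
   Edges are straight segments.  The faces are the orbits of
   [(u, v) |-> (v, prev (nbrs v) u)] on oriented edges: turning clockwise at [v]
   from the edge one arrives by, one follows the boundary of a face keeping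
   it on the left.  [face_center u v] is the center of the circle circumscribed to
   the face on the left of [(u, v)], i.e. a vertex of the dual graph.  Inscribed
   polygons are convex, so the center lies in the (open) face iff it lies
   strictly to the left of each oriented boundary edge. *)
Record isoradial_graph (R : realType) (delta : R) := IsoradialGraph {
  vertex : set R[i];
  nbrs : R[i] -> seq R[i];
  face_center : R[i] -> R[i] -> R[i];
  nbrs_neq0 : forall u, vertex u -> nbrs u != [::];
  nbrs_vertex : forall u v, vertex u -> v \in nbrs u -> vertex v;
  nbrs_sym : forall u v, vertex u -> v \in nbrs u -> u \in nbrs v;
  nbrs_ccw : forall u, vertex u -> ccw_around u (nbrs u);
  noncrossing : forall u v u' v' p,
    vertex u -> v \in nbrs u -> vertex u' -> v' \in nbrs u' ->
    (u', v') != (u, v) -> (u', v') != (v, u) ->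
    segment u v p -> segment u' v' p ->
    p \in [:: u; v] /\ p \in [:: u'; v'];
  center_face : forall u v, vertex u -> v \in nbrs u ->
    face_center v (prev (nbrs v) u) = face_center u v;
  center_dist : forall u v, vertex u -> v \in nbrs u ->
    cabs (u - face_center u v) = delta;
  center_inside : forall u v, vertex u -> v \in nbrs u ->
    left_of u v (face_center u v)
}.

Definition edge (R : realType) (delta : R) (G : isoradial_graph delta)
    (u v : R[i]) : Prop :=
  vertex G u /\ v \in nbrs G u.

(* The rhombus with black diagonal [uv] has vertices [u], [face_center v u], [v],
   [face_center u v], in counterclockwise order, and center [midpoint u v]. *)
Definition rhombus_angles_bounded (R : realType) (delta : R)
    (G : isoradial_graph delta) (eta : R) : Prop :=
  forall u v, edge G u v ->
    let w1 := face_center G v u in let w2 := face_center G u v in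
    eta <= angle (w1 - u) (w2 - u) <= pi - eta /\
    eta <= angle (u - w1) (v - w1) <= pi - eta.

(* The rhombi composing a discrete domain:
   - [inner_rh u v]: the whole rhombus with black diagonal [uv];
   - [white_half u v]: its half [u, w1, w2], where w1 = [face_center v u] and
     w2 = [face_center u v]; w2 - w1 then has the domain on its left;
   - [black_half u v]: its half [w, u, v], where w = [face_center u v]. *)
Record discrete_domain (R : realType) (delta : R) (G : isoradial_graph delta) :=
  DiscreteDomain {
  inner_rh : R[i] -> R[i] -> Prop;
  white_half : R[i] -> R[i] -> Prop;
  black_half : R[i] -> R[i] -> Prop;
  inner_rh_edge : forall u v, inner_rh u v -> edge G u v;
  inner_rh_sym : forall u v, inner_rh u v -> inner_rh v u;
  white_half_edge : forall u v, white_half u v -> edge G u v;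
  black_half_edge : forall u v, black_half u v -> edge G u v
}.

Section Domain.
Variables (R : realType) (delta : R) (G : isoradial_graph delta).
Variable D : discrete_domain G.
Implicit Types (u v w z : R[i]) (F : R[i] -> R[i]) (H : R[i] -> R[i] -> R).

Definition region : set (cplane R) :=
  interior ([set p | exists u v, (inner_rh D u v \/ white_half D u v) /\
                       triangle u (face_center G v u) (face_center G u v) p] `|`
            [set p | exists u v, black_half D u v /\
                       triangle (face_center G u v) u v p] : set (cplane R)).

(* Nonempty, open, connected, and every loop is freely null-homotopic. *)
Definition simply_connected_domain (U : set (cplane R)) : Prop :=
  [/\ U !=set0, open U, connected U &
   forall g : R -> cplane R,
     {within `[0, 1], continuous g} -> g 0 = g 1 ->
     (forall t, 0 <= t <= 1 -> U (g t)) ->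
     exists h : R * R -> cplane R,
     [/\ {within `[0, 1] `*` `[0, 1], continuous h},
         forall s t, 0 <= s <= 1 -> 0 <= t <= 1 -> U (h (s, t)),
         forall t, 0 <= t <= 1 -> h (0, t) = g t,
         exists c, forall t, 0 <= t <= 1 -> h (1, t) = c &
         forall s, 0 <= s <= 1 -> h (s, 0) = h (s, 1)]].

Definition in_boundary (A : set R[i]) : Prop :=
  A `<=` closure region `\` region.

Definition simply_connected_discrete_domain : Prop :=
  [/\ simply_connected_domain region,
      forall u v, white_half D u v ->
        in_boundary (segment (face_center G v u) (face_center G u v)) &
      forall u v, black_half D u v -> in_boundary (segment u v)].

(* Consecutive white boundary half-rhombi, counterclockwise; the pair [(u, v)]
   stands for [white_half u v]. *)
Definition white_arc (L : seq (R[i] * R[i])) : Prop :=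
  [/\ L != [::], uniq L,
      forall u v, (u, v) \in L -> white_half D u v &
      sorted (fun e f => face_center G e.1 e.2 == face_center G f.2 f.1) L].

(* The black vertex [u] lies inside the domain: all the rhombi around it belong
   to the domain, possibly cut along their white diagonal, opposite to [u]. *)
Definition inner_vertex u : Prop :=
  vertex G u /\ forall v, v \in nbrs G u -> inner_rh D u v \/ white_half D u v.

(* [midpoint u v] is the center of a rhombus or half-rhombus of the domain. *)
Definition domain_rh u v : Prop :=
  [\/ inner_rh D u v, white_half D u v \/ white_half D v u |
      black_half D u v \/ black_half D v u].

(* [uw] is an edge of the (half-)rhombus of the domain with center [z]. *)
Definition rh_edge z u w : Prop :=
  exists v, z = midpoint u v /\
  [\/ (inner_rh D u v \/ white_half D u v) /\
        (w = face_center G u v \/ w = face_center G v u),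
      black_half D u v /\ w = face_center G u v |
      black_half D v u /\ w = face_center G v u].

(* The line [i(w-u)]^{-1/2} R does not depend on the branch of the root, and
   neither does [Proj]. *)
Definition Proj (X a : R[i]) : R[i] :=
  X / 2%:R + X^* * a ^+ 2 / (2%:R * `|a| ^+ 2).

Definition edge_dir u w : R[i] := (sqrtc ('i%C * (w - u)))^-1.

Definition s_holomorphic F : Prop :=
  forall z0 z1 u w, rh_edge z0 u w -> rh_edge z1 u w ->
    Proj (F z0) (edge_dir u w) = Proj (F z1) (edge_dir u w).

(* H = Im \int (F(z))^2 dz.  [H z x] is the value at the vertex [x] of the rhombus
   with center [z].  The values given by two (half-)rhombi of the domain agree
   along their common edge, hence at all inner vertices.  Boundary vertices are
   prime ends: a vertex reached from several sides of the boundary, such as the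
   outer black vertex common to two white half-rhombi at a reentrant corner,
   may have one value for each of them.  The second condition holds on the
   full rhombus, even if only one half of it belongs to the domain. *)
Definition im_integral F H : Prop :=
  (forall z0 z1 u w, rh_edge z0 u w -> rh_edge z1 u w ->
     H z0 u = H z1 u /\ H z0 w = H z1 w) /\
  (forall u v w, domain_rh u v -> w = face_center G u v \/ w = face_center G v u ->
     H (midpoint u v) u - H (midpoint u v) w =
     2%:R * delta * cabs (Proj (F (midpoint u v)) (edge_dir u w)) ^+ 2).

(* A star is the list of the rhombi [u, a, x, b] at [u], given as [(a, x, b)];
   [x] is a neighbor of [u]. *)
Definition lattice_star u : seq (R[i] * R[i] * R[i]) :=
  [seq (face_center G v u, v, face_center G u v) | v <- nbrs G u].

(* The half-rhombus [u, w1, w2] cut from the rhombus with black diagonal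
   [u, uout] is replaced by the rhombi [u, w1, ut1, wt] and [u, wt, ut2, w2]. *)
Definition modified_star u uout wt ut1 ut2 : seq (R[i] * R[i] * R[i]) :=
  [seq r <- lattice_star u | r.1.2 != uout] ++
  [:: (face_center G uout u, ut1, wt); (wt, ut2, face_center G u uout)].

Definition laplacian u (st : seq (R[i] * R[i] * R[i])) (h : R[i] -> R) : R :=
  let theta r := half_angle u r.1.1 r.2 in
  let mu := delta ^+ 2 / 2%:R * \sum_(r <- st) sin (theta r *+ 2) in
  mu^-1 * \sum_(r <- st) tan (theta r) * (h r.1.2 - h u).

End Domain.

(* Main.v *)
(* Around [u = uint] number the faces counterclockwise and let
   [t_j = Re (F(z) e^(i b_j))], with [b_j] half the argument of [i(w_j - u)], be
   the signed length of the common projection of the values of [F] on the two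
   rhombi sharing the edge [u w_j].  A computation in one rhombus gives
   [tan th (H v - H u) = 2 delta S(t_(j-1), t_j, th)], where
   [S(a, b, x) = ((a^2 + b^2) cos x - 2 a b) / sin x] is twice the action of the
   harmonic oscillator going from [a] to [b] in time [x].  Minimizing over the
   intermediate position, [S] is subadditive under concatenation of paths.  The
   angles [b_j] increase by [pi] in one turn, so that [t] changes sign, and the
   total action of the half period is nonnegative: this is subharmonicity of
   [H] on the full star, the outer neighbor being included.  The boundary
   condition says that the two projections on the half-rhombus coincide, and
   then [S(a, a, theta) = -2 a^2 tan(theta/2)] is exactly the contribution of
   the two new neighbors. *)

Require Import Defs.
From HB Require Import structures.
From mathcomp Require Import all_boot all_order all_algebra.
From mathcomp Require Import complex.
From mathcomp Require Import boolp classical_sets reals topology normedtype.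
From mathcomp Require Import trigo.
From mathcomp Require Import ring lra.

Set Implicit Arguments.
Unset Strict Implicit.
Unset Printing Implicit Defensive.

Import Order.TTheory GRing.Theory Num.Theory.
Local Open Scope ring_scope.

(** * Action of the harmonic oscillator over half a period *)

Definition oscillator_action (R : realType) (a b x : R) : R :=
  ((a ^+ 2 + b ^+ 2) * cos x - 2 * a * b) / sin x.

(* The difference of the two sides is a positive multiple of the square of an
   affine function of [b]. *)
Lemma oscillator_action_subadd (R : realType) (a b c x y : R) :
  0 < x -> 0 < y -> x + y < pi ->
  oscillator_action a c (x + y) <=
  oscillator_action a b x + oscillator_action b c y.
Proof.
move=> x0 y0 xy; rewrite /oscillator_action.
have sx : 0 < sin x by apply: sin_gt0_pi; lra.
have sy : 0 < sin y by apply: sin_gt0_pi; lra.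
have sxy : 0 < sin (x + y) by apply: sin_gt0_pi; lra.
have sE := sinD x y; have cE := cosD x y.
have cx := cos2sin2 x; have cy := cos2sin2 y.
rewrite -subr_ge0.
suff -> : ((a ^+ 2 + b ^+ 2) * cos x - 2 * a * b) / sin x +
  ((b ^+ 2 + c ^+ 2) * cos y - 2 * b * c) / sin y -
  ((a ^+ 2 + c ^+ 2) * cos (x + y) - 2 * a * c) / sin (x + y) =
  (b * sin (x + y) - a * sin y - c * sin x) ^+ 2
    / (sin x * sin y * sin (x + y)).
  by rewrite divr_ge0 ?sqr_ge0 // !mulr_ge0 // ltW.
move: (sin x) (cos x) (sin y) (cos y) (sin (x + y)) (cos (x + y))
  sx sy sxy sE cE cx cy.
move=> s1 c1 s2 c2 s c0 s10 s20 s0 sE cE e1 e2.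
have n1 : s1 != 0 by rewrite gt_eqF.
have n2 : s2 != 0 by rewrite gt_eqF.
have n3 : s != 0 by rewrite gt_eqF.
have n4 : s1 * c2 + c1 * s2 != 0 by rewrite -sE.
subst s c0; field: e1 e2; by rewrite n1 n2 n4.
Qed.

(** Under [x -> pi - x] the cosine changes sign and the sine does not, while the product term
    changes sign with [a], so the two numerators are opposite. This identity closes the half
    period. *)
Lemma oscillator_action_antiperiodic (R : realType) (a b x : R) :
  oscillator_action a b x + oscillator_action b (- a) (pi - x) = 0.
Proof.
rewrite /oscillator_action [pi - x]addrC sinDpi cosDpi sinN cosN opprK.
rewrite -mulrDl (_ : _ + _ = 0) ?mul0r //.
by ring.
Qed.

Lemma oscillator_sum_ge (R : realType) (t B : nat -> R) (m : nat) :
  (forall j, (j <= m)%N -> B j < B j.+1) -> B m.+1 < B 0 + pi ->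
  oscillator_action (t 0) (t m.+1) (B m.+1 - B 0) <=
  \sum_(j < m.+1) oscillator_action (t j) (t j.+1) (B j.+1 - B j).
Proof.
elim: m => [|m IH] Bi Bpi; first by rewrite big_ord1.
have B1 := Bi m.+1 (leqnn _).
have B2 : B 0 < B m.+1.
  elim: (m) Bi => [|k IHk] Bi; first exact: Bi.
  exact: lt_trans (IHk (fun j jk => Bi j (leqW jk))) (Bi k.+1 (leqnSn _)).
rewrite big_ord_recr /=.
have := IH (fun j jm => Bi j (leqW jm)) (lt_trans B1 Bpi).
have -> : B m.+2 - B 0 = (B m.+1 - B 0) + (B m.+2 - B m.+1) by ring.
have := @oscillator_action_subadd R (t 0) (t m.+1) (t m.+2)
  (B m.+1 - B 0) (B m.+2 - B m.+1).
by lra.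
Qed.

(** Subadditivity stops short of total time [pi], where the sine vanishes. So all pieces but the
    last are merged into one, and antiperiodicity makes that one cancel exactly against the last
    piece, which ends at [- t 0]. *)
Lemma oscillator_sum_ge0 (R : realType) (t B : nat -> R) (n : nat) :
  (1 < n)%N -> (forall j, (j < n)%N -> B j < B j.+1) ->
  B n = B 0 + pi -> t n = - t 0 ->
  0 <= \sum_(j < n) oscillator_action (t j) (t j.+1) (B j.+1 - B j).
Proof.
case: n => [//|[//|m]] _ Bi Bn tn.
rewrite big_ord_recr /= tn Bn.
have := @oscillator_sum_ge R t B m (fun j jm => Bi j (leqW jm)).
have -> : B 0 + pi - B m.+1 = pi - (B m.+1 - B 0) by ring.
have := oscillator_action_antiperiodic (t 0) (t m.+1) (B m.+1 - B 0).
have := Bi m.+1 (leqnn _); rewrite Bn.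
by lra.
Qed.

(** * Unit complex numbers and projections *)

Definition expi (R : realType) (x : R) : R[i] := (cos x +i* sin x)%C.

Lemma complex_eqP (R : realType) (x y : R[i]) :
  complex.Re x = complex.Re y -> complex.Im x = complex.Im y -> x = y.
Proof. by case: x y => ? ? [? ?] /= -> ->. Qed.

Lemma expiD (R : realType) (x y : R) : expi (x + y) = expi x * expi y.
Proof. by apply: complex_eqP => /=; rewrite ?cosD ?sinD //; ring. Qed.

Lemma conj_expi (R : realType) (x : R) : (expi x)^* = expi (- x).
Proof. by rewrite /expi cosN sinN. Qed.

Lemma expi0 (R : realType) : expi (0 : R) = 1.
Proof. by rewrite /expi cos0 sin0. Qed.

Lemma expi_pihalf (R : realType) : expi (pi / 2 : R) = 'i%C.
Proof. by rewrite /expi cos_pihalf sin_pihalf. Qed.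

Lemma expi_pi (R : realType) : expi (pi : R) = - 1.
Proof. by apply: complex_eqP; rewrite /= ?cospi ?sinpi ?oppr0. Qed.

Lemma cabs_scale (R : realType) (d x : R) : 0 <= d ->
  cabs ((d%:C)%C * expi x) = d.
Proof.
move=> d0; rewrite /cabs normc_def /= !mul0r subr0 addr0.
rewrite !exprMn -mulrDr cos2Dsin2 mulr1 sqrtr_sqr ger0_norm //.
Qed.

Lemma normr_expi (R : realType) (x : R) : `|expi x| = 1.
Proof. by rewrite normc_def /= cos2Dsin2 sqrtr1. Qed.

Lemma expi_neq0 (R : realType) (x : R) : expi x != 0.
Proof. by rewrite -normr_eq0 normr_expi oner_eq0. Qed.

(** Only the square of [edge_dir u w] and the square of its modulus enter [Proj], and their quotient
    is [expi (- (b *+ 2))]: the branch of the root disappears. The projection is onto the line of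
    [expi (- b)], with signed length the real part of [X * expi b]. *)
Lemma Proj_edge_dir (R : realType) (d b : R) (X u w : R[i]) : 0 < d ->
  'i%C * (w - u) = (d%:C)%C * expi (b *+ 2) ->
  Proj X (edge_dir u w) = ((complex.Re (X * expi b))%:C)%C * expi (- b).
Proof.
move=> d0 e; rewrite /Proj /edge_dir e exprVn sqr_sqrtc.
have dn0 : (d%:C)%C != 0 :> R[i] by rewrite eq_complex /= gt_eqF.
rewrite normfV exprVn -normrX sqr_sqrtc normrM normr_expi mulr1.
rewrite [`|_%:C|%C]ger0_norm ?lecR ?ltW //.
have -> : expi (b *+ 2) = expi b ^+ 2 by rewrite mulr2n expiD expr2.
have bE : expi (- b) = (expi b)^-1.
  by apply: (mulfI (expi_neq0 b)); rewrite -expiD subrr expi0 divff ?expi_neq0.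
have -> : ((complex.Re (X * expi b))%:C)%C = (X * expi b + X^* / expi b) / 2%:R.
  by rewrite -bE -conj_expi -rmorphM; exact: ReJ_add.
rewrite bE; field; by rewrite dn0 expi_neq0.
Qed.

Lemma cabs_Proj_edge_dir (R : realType) (d b : R) (X u w : R[i]) : 0 < d ->
  'i%C * (w - u) = (d%:C)%C * expi (b *+ 2) ->
  cabs (Proj X (edge_dir u w)) ^+ 2 = complex.Re (X * expi b) ^+ 2.
Proof.
move=> d0 e; rewrite (Proj_edge_dir X d0 e) /cabs normrM normr_expi mulr1.
by rewrite normc_def /= expr0n addr0 sqrtr_sqr real_normK ?num_real.
Qed.

Lemma half_angle_expi (R : realType) (d al th : R) (u a b : R[i]) :
  0 < d -> 0 <= th <= pi / 2 ->
  a - u = (d%:C)%C * expi (al - th) -> b - u = (d%:C)%C * expi (al + th) ->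
  half_angle u a b = th.
Proof.
move=> d0 th0 ea eb; rewrite /half_angle /angle ea eb !cabs_scale ?ltW //.
have -> : ((d%:C)%C * expi (al + th))^* = (d%:C)%C * expi (- (al + th)).
  by rewrite -conj_expi; apply: complex_eqP => /=; ring.
rewrite mulrACA -expiD.
have -> : al - th + - (al + th) = - (th *+ 2) by ring.
have -> : complex.Re ((d%:C)%C * (d%:C)%C * expi (- (th *+ 2)))
    = d * d * cos (th *+ 2) by rewrite /= cosN; ring.
rewrite [d * d * _]mulrC mulfK ?mulf_neq0 ?gt_eqF // cosK; first by field.
by rewrite in_itv /=; lra.
Qed.

(** * Geometry of a single rhombus, and the boundary condition *)

Lemma face_center_polar (R : realType) (delta : R) (G : isoradial_graph delta)
    (u v : R[i]) (r al : R) :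
  0 < delta -> edge G u v -> 0 < r -> v - u = (r%:C)%C * expi al ->
  exists th : R, [/\ 0 < th < pi / 2, r = 2 * delta * cos th,
    face_center G u v - u = (delta%:C)%C * expi (al + th) &
    face_center G v u - u = (delta%:C)%C * expi (al - th)].
Proof.
move=> d0 [Gu uv] r0 vE.
have Gv := nbrs_vertex Gu uv; have vu := nbrs_sym Gu uv.
(* [center_dist] only speaks of the origin of an oriented edge; the far endpoint [y] is the origin
   of the next edge of the same face, which has the same center. *)
have cp (x y : R[i]) : edge G x y -> cabs (y - face_center G x y) = delta.
  move=> [Gx xy]; rewrite -(center_face Gx xy).
  apply: center_dist; first exact: nbrs_vertex xy.
  by rewrite mem_prev; exact: nbrs_sym.
have sqE (z : R[i]) : cabs z = delta ->
    complex.Re z ^+ 2 + complex.Im z ^+ 2 = delta ^+ 2.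
  by move=> <-; rewrite /cabs normc_def /= sqr_sqrtr // addr_ge0 ?sqr_ge0.
(* In the frame rotated by [- al], a point equidistant from [u] and [v] lies on the perpendicular
   bisector of [[uv]], so its first coordinate is [r / 2]. *)
have polar (w : R[i]) : cabs (u - w) = delta -> cabs (v - w) = delta ->
    exists y, w - u = (r / 2 +i* y)%C * expi al /\
              (r / 2) ^+ 2 + y ^+ 2 = delta ^+ 2.
  move=> /sqE h1 /sqE h2.
  pose z := (w - u) * expi (- al).
  have zE : w - u = z * expi al.
    by rewrite /z -mulrA -expiD addNr expi0 mulr1.
  have uw : u - w = - (z * expi al) by rewrite -zE opprB.
  have vw : v - w = ((r%:C)%C - z) * expi al.
    by rewrite mulrBl -vE -zE; ring.
  move: h1 h2; rewrite uw vw zE; case: z {zE uw vw} => x y /=.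
  have := cos2Dsin2 al; move: (cos al) (sin al) => c s cs h1 h2.
  have h1' : x ^+ 2 + y ^+ 2 = delta ^+ 2.
    by rewrite -h1 -[LHS]mulr1 -cs; ring.
  have h2' : (r - x) ^+ 2 + y ^+ 2 = delta ^+ 2.
    by rewrite -h2 -[LHS]mulr1 -cs; ring.
  have xr : x = r / 2.
    apply: (mulfI (lt0r_neq0 r0)); lra.
  by exists y; rewrite -xr.
have [y [yE y2]] := polar _ (center_dist Gu uv) (cp _ _ (conj Gu uv)).
have [y' [yE' y2']] := polar _ (cp _ _ (conj Gv vu)) (center_dist Gv vu).
(* Each center is strictly to the left of its own oriented edge, and the two edges are opposite.
   This gives [y] and [y'] opposite signs; their squares being equal, the centers are mirror images
   in [[uv]]. *)
have y0 : 0 < y.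
  have := center_inside Gu uv; rewrite /left_of yE vE /=.
  have := cos2Dsin2 al; move: (cos al) (sin al) => c s cs.
  set p := (X in 0 < X).
  have -> : p = r * y * (c ^+ 2 + s ^+ 2) by rewrite /p; ring.
  by rewrite cs mulr1 pmulr_rgt0.
have y0' : y' < 0.
  have := center_inside Gv vu; rewrite /left_of.
  have -> : face_center G v u - v = (face_center G v u - u) - (v - u) by ring.
  have -> : u - v = - (v - u) by ring.
  rewrite yE' vE /=.
  have := cos2Dsin2 al; move: (cos al) (sin al) => c s cs.
  set p := (X in 0 < X).
  have -> : p = r * - y' * (c ^+ 2 + s ^+ 2) by rewrite /p; ring.
  by rewrite cs mulr1 pmulr_rgt0 // oppr_gt0.
have yy : y' = - y.
  have : (y - y') * (y + y') = 0 by lra.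
  by move/eqP; rewrite mulf_eq0 => /orP[] /eqP; lra.
have q1 : -1 <= r / 2 / delta <= 1.
  rewrite ler_pdivlMr // ler_pdivrMr //; nra.
pose th := acos (r / 2 / delta).
have cth : cos th = r / 2 / delta by rewrite /th acosK // in_itv.
have th1 : 0 <= th <= pi by rewrite acos_ge0 ?acos_lepi.
have cth0 : 0 < cos th by rewrite cth !divr_gt0.
have th2 : th < pi / 2.
  have pi0 := pi_gt0 R; rewrite ltNge le_eqVlt; apply/negP => /orP[/eqP h|h].
    by move: cth0; rewrite -h cos_pihalf ltxx.
  have : cos th < cos (pi / 2) by rewrite ltr_cos ?in_itv /=; lra.
  by rewrite cos_pihalf ltNge (ltW cth0).
have c1 : cos th < 1.
  rewrite cth ltr_pdivrMr // mul1r; nra.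
have th0 : 0 < th.
  rewrite lt0r; case/andP: th1 => -> _; rewrite andbT.
  by apply/eqP => t0; move: c1; rewrite t0 cos0 ltxx.
have sth0 : 0 < sin th by apply: sin_gt0_pihalf; rewrite th0.
have rE : r / 2 = delta * cos th by rewrite cth mulrCA divff ?mulr1 ?gt_eqF.
have sE : y = delta * sin th.
  have /eqP : y ^+ 2 = (delta * sin th) ^+ 2.
    by rewrite exprMn sin2cos2 mulrBr mulr1 -exprMn -rE -y2 addrC addKr.
  by rewrite eqf_sqr => /orP[] /eqP // ?; nra.
exists th; split.
- by rewrite th0.
- by rewrite -mulrA -rE; field.
- by rewrite yE rE sE; apply: complex_eqP => /=; rewrite ?cosD ?sinD; ring.
- by rewrite yE' yy rE sE; apply: complex_eqP => /=; rewrite ?cosB ?sinB; ring.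
Qed.

Definition rhombus_polar (R : realType) (delta : R) (u v w w' : R[i])
    (al th : R) : Prop :=
  [/\ 0 < th < pi / 2, v - u = ((2 * delta * cos th)%:C)%C * expi al,
    w - u = (delta%:C)%C * expi (al + th) &
    w' - u = (delta%:C)%C * expi (al - th)].

(* Half the argument of [i(w - u)] on an edge [uw] with direction [x]. *)
Definition edge_phase (R : realType) (x : R) : R := x / 2 + pi / 4.

Lemma edge_phase_dir (R : realType) (delta x : R) (z : R[i]) :
  z = (delta%:C)%C * expi x ->
  'i%C * z = (delta%:C)%C * expi (edge_phase x *+ 2).
Proof.
move=> ->; rewrite mulrCA -expi_pihalf -expiD; congr (_ * expi _).
by rewrite /edge_phase; field.
Qed.

Lemma edge_phaseD (R : realType) (al th : R) :
  edge_phase (al + th) = edge_phase (al - th) + th.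
Proof. by rewrite /edge_phase; field. Qed.

Lemma rhombus_polar_opp (R : realType) (delta : R) (u v w w' : R[i])
    (al th : R) :
  rhombus_polar delta u v w w' al th -> w + w' = u + v.
Proof.
move=> [_ vE wE wE']; apply: (addIr (- u - u)).
have -> : w + w' + (- u - u) = (w - u) + (w' - u) by ring.
have -> : u + v + (- u - u) = v - u by ring.
rewrite vE wE wE'; apply: complex_eqP => /=;
  rewrite ?cosD ?sinD ?cosN ?sinN; ring.
Qed.

(** Opposite sides of a rhombus are parallel, so the phase of [[vw]] is that of [[uw']] plus
    [pi / 2]. With [Z] the product of [X] and the unit number of phase [al - th], the increment at
    [v] is thus [2 delta (Im Z)^2], while [a = Re Z] and [b = a cos th - Im Z sin th]. Eliminating
    [Im Z] yields the action. *)
Lemma rhombus_increments (R : realType) (delta : R) (u v w w' X : R[i])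
    (al th hu hv hw hw' : R) :
  0 < delta -> rhombus_polar delta u v w w' al th ->
  hu - hw = 2 * delta * cabs (Proj X (edge_dir u w)) ^+ 2 ->
  hu - hw' = 2 * delta * cabs (Proj X (edge_dir u w')) ^+ 2 ->
  hv - hw = 2 * delta * cabs (Proj X (edge_dir v w)) ^+ 2 ->
  let a := complex.Re (X * expi (edge_phase (al - th))) in
  let b := complex.Re (X * expi (edge_phase (al + th))) in
  [/\ hu - hw = 2 * delta * b ^+ 2, hu - hw' = 2 * delta * a ^+ 2 &
    tan th * (hv - hu) = 2 * delta * oscillator_action a b th].
Proof.
move=> d0 P; have [th0 vE wE wE'] := P; have opp := rhombus_polar_opp P.
have wv : 'i%C * (w - v) =
    (delta%:C)%C * expi ((edge_phase (al - th) + pi / 2) *+ 2).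
  have -> : w - v = - (w' - u).
    by rewrite -[w](addrK w') opp; ring.
  have -> : (edge_phase (al - th) + pi / 2) *+ 2 =
      edge_phase (al - th) *+ 2 + pi by field.
  by rewrite mulrN (edge_phase_dir wE') [expi (_ + pi)]expiD expi_pi; ring.
rewrite (cabs_Proj_edge_dir X d0 (edge_phase_dir wE)).
rewrite (cabs_Proj_edge_dir X d0 (edge_phase_dir wE')).
rewrite (cabs_Proj_edge_dir X d0 wv) => e1 e2 e3 a b; split => //.
have -> : hv - hu = (hv - hw) - (hu - hw) by ring.
rewrite e1 e3 /b /a (edge_phaseD al th); move: (edge_phase (al - th)) => phi.
rewrite !expiD expi_pihalf /tan /oscillator_action.
have sth : sin th != 0 by rewrite gt_eqF // sin_gt0_pihalf.
have cth : cos th != 0 by rewrite gt_eqF // cos_gt0_pihalf //; lra.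
have := cos2sin2 th.
move: sth cth; case: X {e1 e2 e3 a b} => x y /=.
move: (cos th) (sin th) (cos _) (sin _) => c s c1 s1 s0 c0 cs.
by field: cs; rewrite s0 c0.
Qed.

(** The phase [m] of the axis [al] satisfies [w - w' = k expi(m)^2] with [k > 0], so [(X expi m)^2]
    is a nonnegative real and [X expi m] is real. The two edges have phases [m - th / 2] and
    [m + th / 2], symmetric about [m], and a real number has equal real parts after opposite
    rotations. *)
Lemma parallel_equal_projections (R : realType) (delta : R)
    (u v w w' X : R[i]) (al th : R) :
  0 < delta -> rhombus_polar delta u v w w' al th ->
  parallel X (sqrtc (w - w'))^-1 ->
  complex.Re (X * expi (edge_phase (al - th))) =
  complex.Re (X * expi (edge_phase (al + th))).
Proof.
move=> d0 [th0 vE wE wE'] [t XE].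
have sth : 0 < sin th by rewrite sin_gt0_pihalf.
pose m := edge_phase al; pose k := 2 * delta * sin th.
have k0 : 0 < k by rewrite !mulr_gt0.
have ww : w - w' = (k%:C)%C * expi m ^+ 2.
  rewrite expr2 -expiD -mulr2n.
  have -> : m *+ 2 = al + pi / 2 by rewrite /m /edge_phase; field.
  have -> : w - w' = (w - u) - (w' - u) by ring.
  rewrite wE wE' !expiD expi_pihalf; apply: complex_eqP => /=;
    rewrite ?cosD ?sinD ?cosN ?sinN /k; ring.
have Y2 : (X * expi m) ^+ 2 = ((t ^+ 2 / k)%:C)%C.
  have kn0 : (k%:C)%C != 0 :> R[i] by rewrite eq_complex /= gt_eqF.
  have -> : ((t ^+ 2 / k)%:C)%C = (t%:C)%C ^+ 2 / (k%:C)%C.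
    by rewrite -rmorphXn -fmorphV -rmorphM.
  rewrite XE exprMn exprMn exprVn sqr_sqrtc ww.
  by field; rewrite kn0 expi_neq0.
have -> : edge_phase (al - th) = m + - (th / 2).
  by rewrite /m /edge_phase; field.
have -> : edge_phase (al + th) = m + th / 2 by rewrite /m /edge_phase; field.
rewrite !(expiD m) !mulrA; move: (X * expi m) Y2 => [p q] /eqP.
rewrite expr2 eq_complex /= => /andP[/eqP e1 /eqP e2].
have e3 : 0 <= p * p - q * q by rewrite e1 divr_ge0 ?sqr_ge0 ?ltW.
have q0 : q = 0.
  have /eqP : p * q = 0 by lra.
  by rewrite mulf_eq0 => /orP[] /eqP // p0; move: e3; rewrite p0; nra.
by rewrite q0 cosN sinN; ring.
Qed.

Lemma Re_mul_expi_eq (R : realType) (delta x : R) (u w X Y : R[i]) :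
  0 < delta -> w - u = (delta%:C)%C * expi x ->
  Proj X (edge_dir u w) = Proj Y (edge_dir u w) ->
  complex.Re (X * expi (edge_phase x)) = complex.Re (Y * expi (edge_phase x)).
Proof.
move=> d0 /edge_phase_dir e; rewrite !(Proj_edge_dir _ d0 e).
by move/(mulIf (expi_neq0 _)) => [].
Qed.

Lemma oscillator_action_diag (R : realType) (a x : R) : 0 < x < pi / 2 ->
  oscillator_action a a x = - (2 * a ^+ 2 * tan (x / 2)).
Proof.
move=> x0; rewrite /oscillator_action /tan.
have s0 : sin (x / 2) != 0 by rewrite gt_eqF // sin_gt0_pihalf //; lra.
have c0 : cos (x / 2) != 0 by rewrite gt_eqF // cos_gt0_pihalf //; lra.
have xE : x = x / 2 + x / 2 by field.
rewrite {1 2}xE cosD sinD; have := cos2sin2 (x / 2); move: s0 c0.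
move: (cos _) (sin _) => c s s0 c0 cs; field: cs.
by rewrite c0 [c * s]mulrC -mulr2n mulrn_eq0 /= mulf_neq0.
Qed.

(** * Cyclic order of the rhombi around a vertex *)

Lemma expi_inj (R : realType) (x y : R) :
  - (pi *+ 2) < y - x < pi *+ 2 -> expi x = expi y -> x = y.
Proof.
move=> d [ce se].
have : sin ((y - x) / 2) ^+ 2 = 0.
  have -> : sin ((y - x) / 2) ^+ 2 = (1 - cos (y - x)) / 2.
    rewrite {2}(_ : y - x = (y - x) / 2 + (y - x) / 2) ?cosD; last by field.
    by rewrite -!expr2 cos2sin2; field.
  by rewrite cosB ce se -!expr2 cos2Dsin2 subrr mul0r.
move/eqP; rewrite sqrf_eq0 => /eqP s0.
case: (ltgtP x y) => // xy.
  have : 0 < sin ((y - x) / 2) by apply: sin_gt0_pi; lra.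
  by rewrite s0 ltxx.
have : 0 < sin ((x - y) / 2) by apply: sin_gt0_pi; lra.
by rewrite -opprB mulNr sinN s0 oppr0 ltxx.
Qed.

Lemma expi_scale_eq (R : realType) (r r' x y : R) : 0 < r -> 0 < r' ->
  (r%:C)%C * expi x = (r'%:C)%C * expi y -> expi x = expi y.
Proof.
move=> r0 r0' e; have rr : r = r'.
  by rewrite -(cabs_scale x (ltW r0)) e cabs_scale ?ltW.
move: e; rewrite rr; apply: mulfI.
by rewrite eq_complex /= gt_eqF.
Qed.

Lemma complex_polarE (R : realType) (r x : R) :
  ((r * cos x) +i* (r * sin x))%C = (r%:C)%C * expi x.
Proof. by apply: complex_eqP => /=; ring. Qed.

(** Any two listed arguments differ by less than a full turn, so the directions are distinct.
    Uniqueness is what makes [prev] the shift of positions. *)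
Lemma ccw_around_uniq (R : realType) (u : R[i]) (s : seq R[i]) :
  ccw_around u s -> uniq s.
Proof.
move=> [r [a [pol mono turn]]]; apply/(uniqP 0) => j k; rewrite !inE => js ks e.
wlog jk : j k js ks e / (j < k)%N.
  by move=> h; case: (ltngtP j k) => // ?; [exact: h|apply/esym/h].
have [rj ej] := pol j js; have [rk ek] := pol k ks.
have ajk : a j < a k by apply: mono; rewrite jk ks.
have akj : a k < a j + pi *+ 2.
  have := turn k ks; case: (posnP j) => [->//|j0].
  by have := mono 0%N j; rewrite j0 js => /(_ isT); lra.
have : expi (a j) = expi (a k).
  by apply: (expi_scale_eq rj rk); rewrite -!complex_polarE -ej -ek e.
move/expi_inj => h; have pi0 := pi_gt0 R.
have /h ajk' : - (pi *+ 2) < a k - a j < pi *+ 2 by lra.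
by move: ajk; rewrite ajk' ltxx.
Qed.

Lemma prev_nthS (T : eqType) (x0 : T) (s : seq T) (j : nat) :
  uniq s -> (j.+1 < size s)%N -> prev s (nth x0 s j.+1) = nth x0 s j.
Proof.
move=> us js; rewrite prev_nth mem_nth //; case: s us js => //= y s.
move=> /andP[_ us]; rewrite ltnS => js; rewrite index_uniq //.
by apply: set_nth_default; rewrite ltnS ltnW.
Qed.

Lemma prev_nth0 (T : eqType) (x0 : T) (s : seq T) :
  uniq s -> prev s (nth x0 s 0) = nth x0 s (size s).-1.
Proof.
rewrite prev_nth; case: s => //= y s /andP[ys _].
by rewrite inE eqxx memNindex //; apply: set_nth_default.
Qed.

Section Star.
Variables (R : realType) (delta : R) (G : isoradial_graph delta) (u : R[i]).
Hypotheses (delta_gt0 : 0 < delta) (Gu : vertex G u).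
Let s := nbrs G u.

Lemma face_center_prev v : v \in s ->
  face_center G u (prev s v) = face_center G v u.
Proof.
by move=> vs; apply: center_face; [exact: nbrs_vertex vs|exact: nbrs_sym].
Qed.

Lemma nbrs_uniq : uniq s.
Proof. exact: ccw_around_uniq (nbrs_ccw Gu). Qed.

Lemma face_center_nthS j : (j.+1 < size s)%N ->
  face_center G u s`_j = face_center G s`_j.+1 u.
Proof.
by move=> js; rewrite -face_center_prev ?mem_nth // prev_nthS ?nbrs_uniq.
Qed.

Lemma face_center_nth_last :
  face_center G u s`_(size s).-1 = face_center G s`_0 u.
Proof.
have s0 : (0 < size s)%N by rewrite lt0n size_eq0; exact: nbrs_neq0.
by rewrite -face_center_prev ?mem_nth // prev_nth0 ?nbrs_uniq.
Qed.

Definition nbr_half_angle v :=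
  half_angle u (face_center G v u) (face_center G u v).

Lemma star_polar : exists a : nat -> R,
  [/\ forall j, (j < size s)%N ->
        rhombus_polar delta u s`_j (face_center G u s`_j)
          (face_center G s`_j u) (a j) (nbr_half_angle s`_j),
      forall j, (j.+1 < size s)%N ->
        a j.+1 = a j + nbr_half_angle s`_j + nbr_half_angle s`_j.+1,
      a 0%N + pi *+ 2 = a (size s).-1 + nbr_half_angle s`_(size s).-1
                          + nbr_half_angle s`_0 &
      (1 < size s)%N].
Proof.
have s0 : (0 < size s)%N by rewrite lt0n size_eq0; exact: nbrs_neq0.
have pi0 := pi_gt0 R.
have [r [a [pol mono turn]]] := nbrs_ccw Gu; exists a.
have P j : (j < size s)%N ->
    rhombus_polar delta u s`_j (face_center G u s`_j)
      (face_center G s`_j u) (a j) (nbr_half_angle s`_j).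
  move=> js; have [rj ej] := pol j js; rewrite complex_polarE in ej.
  have [th [th0 rE e1 e2]] :=
    face_center_polar delta_gt0 (conj Gu (mem_nth 0 js)) rj ej.
  have -> : nbr_half_angle s`_j = th.
    by apply: half_angle_expi delta_gt0 _ e2 e1; lra.
  by split=> //; rewrite ej rE.
(* [x] is a lift of the argument [a k]: [a k] itself for consecutive neighbors, [a 0 + 2 pi] when
   the turn closes. The upper bound on [x] is not strict because the first and last neighbors have
   not yet been shown to be distinct. *)
have chain j k x : (j < size s)%N -> (k < size s)%N ->
    face_center G u s`_j = face_center G s`_k u ->
    expi x = expi (a k) -> a j < x <= a j + pi *+ 2 ->
    x = a j + nbr_half_angle s`_j + nbr_half_angle s`_k.
  move=> js ks fE xE xj.
  have [tj _ ej _] := P j js; have [tk _ _ ek] := P k ks.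
  have : expi (a j + nbr_half_angle s`_j) = expi (x - nbr_half_angle s`_k).
    apply: (expi_scale_eq delta_gt0 delta_gt0).
    by rewrite -ej fE ek !expiD xE.
  move/expi_inj => h.
  have /h : - (pi *+ 2) < x - nbr_half_angle s`_k -
    (a j + nbr_half_angle s`_j) < pi *+ 2 by lra.
  by lra.
have lt_last : (size s).-1 = 0%N \/ a 0%N < a (size s).-1.
  case: (posnP (size s).-1) => [|l0]; [by left|right].
  by apply: mono; rewrite l0 /= ltn_predL.
have turn_last : a 0%N + pi *+ 2 = a (size s).-1 +
    nbr_half_angle s`_(size s).-1 + nbr_half_angle s`_0.
  apply: (chain _ 0%N) => //; rewrite ?ltn_predL //.
  - exact: face_center_nth_last.
  - by rewrite /expi cosD2pi sinD2pi.
  - have := turn (size s).-1; rewrite ltn_predL => /(_ s0).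
    by case: lt_last => [->|]; lra.
split => //.
- move=> j js; apply: chain => //; [exact: ltnW|exact: face_center_nthS|].
  have := mono j j.+1; rewrite ltnSn js => /(_ isT).
  have := turn _ js; case: (posnP j) => [->|j0]; first by lra.
  by have := mono 0%N j; rewrite j0 (ltnW js) => /(_ isT); lra.
(* A single neighbor would make the closing relation read [2 pi = 2 th], against [th < pi / 2]. *)
- rewrite ltnNge; apply/negP => s1; move: turn_last.
  have -> : (size s).-1 = 0%N by case: (size s) s1 => [|[]].
  by have [t0 _ _ _] := P 0%N s0; lra.
Qed.

End Star.

(** * Subharmonicity on the full star *)

Lemma inner_rh_edge_faces (R : realType) (delta : R)
    (G : isoradial_graph delta) (D : discrete_domain G) (u v : R[i]) :
  inner_vertex D u -> v \in nbrs G u ->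
  rh_edge D (midpoint u v) u (face_center G u v) /\
  rh_edge D (midpoint u v) u (face_center G v u).
Proof.
by move=> [_ inner] vs; split; exists v; split=> //; apply: Or31;
  split; auto.
Qed.

(** Both orders matter: the increment along the edge [[vw]] is read at [v], also when [v] is the
    outer vertex of a half-rhombus. *)
Lemma inner_domain_rh (R : realType) (delta : R)
    (G : isoradial_graph delta) (D : discrete_domain G) (u v : R[i]) :
  inner_vertex D u -> v \in nbrs G u -> domain_rh D u v /\ domain_rh D v u.
Proof.
move=> [_ inner] /inner[h|h].
  by split; apply: Or31 => //; exact: inner_rh_sym.
by split; apply: Or32; [left|right].
Qed.

Lemma inner_rhombus_increments (R : realType) (delta : R)
    (G : isoradial_graph delta) (D : discrete_domain G)
    (F : R[i] -> R[i]) (H : R[i] -> R[i] -> R) (u v : R[i]) (al th : R) :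
  0 < delta -> inner_vertex D u -> v \in nbrs G u -> im_integral D F H ->
  rhombus_polar delta u v (face_center G u v) (face_center G v u) al th ->
  let z := midpoint u v in
  let a := complex.Re (F z * expi (edge_phase (al - th))) in
  let b := complex.Re (F z * expi (edge_phase (al + th))) in
  [/\ H z u - H z (face_center G u v) = 2 * delta * b ^+ 2,
    H z u - H z (face_center G v u) = 2 * delta * a ^+ 2 &
    tan th * (H z v - H z u) = 2 * delta * oscillator_action a b th].
Proof.
move=> d0 inner vs [_ Hd] P z.
have [duv dvu] := inner_domain_rh inner vs.
have zE : midpoint v u = z by rewrite /z /midpoint addrC.
apply: (rhombus_increments d0 P).
- by apply: Hd => //; left.
- by apply: Hd => //; right.
- by have := Hd v u _ dvu (or_intror erefl); rewrite zE.
Qed.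

Lemma star_sum_ge0 (R : realType) (delta : R)
    (G : isoradial_graph delta) (D : discrete_domain G)
    (F : R[i] -> R[i]) (H : R[i] -> R[i] -> R) (u : R[i]) :
  0 < delta -> inner_vertex D u -> s_holomorphic D F -> im_integral D F H ->
  0 <= \sum_(v <- nbrs G u) tan (nbr_half_angle G u v) *
         (H (midpoint u v) v - H (midpoint u v) u).
Proof.
move=> d0 inner holo imH; have Gu := inner.1.
have [a [P aS a_last s1]] := star_polar d0 Gu.
set s := nbrs G u in P aS a_last s1 *; set n := size s.
pose th j := nbr_half_angle G u s`_j; pose z j := midpoint u s`_j.
(* Index [0] is the edge preceding the first rhombus and [k.+1] the edge following rhombus [k], so
   rhombus [j] lies between [j] and [j.+1]. The phases are kept as real numbers, not modulo [pi], so
   that the change of sign after one turn is visible. *)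
pose B j := if j is k.+1 then edge_phase (a k + th k)
            else edge_phase (a 0%N - th 0%N).
pose t j := if j is k.+1 then complex.Re (F (z k) * expi (B k.+1))
            else complex.Re (F (z 0%N) * expi (B 0%N)).
have mem j : (j < n)%N -> s`_j \in nbrs G u by move=> jn; exact: mem_nth.
have BE j : (j < n)%N -> B j = edge_phase (a j - th j).
  case: j => // k kn; rewrite /B aS // -/(th k) -/(th k.+1).
  by congr edge_phase; ring.
(* By definition [t j] is read in the rhombus before edge [j]; s-holomorphicity allows reading it in
   the rhombus after it. *)
have tE j : (j < n)%N -> t j = complex.Re (F (z j) * expi (B j)).
  case: j => // k kn; have kn' := ltnW kn.
  have [_ _ wE _] := P k kn'; apply: Re_mul_expi_eq d0 wE _.
  apply: holo; first exact: (inner_rh_edge_faces inner (mem k kn')).1.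
  rewrite (face_center_nthS Gu kn).
  exact: (inner_rh_edge_faces inner (mem k.+1 kn)).2.
have -> : \sum_(v <- s) tan (nbr_half_angle G u v) *
    (H (midpoint u v) v - H (midpoint u v) u) =
    2 * delta * \sum_(j < n) oscillator_action (t j) (t j.+1) (B j.+1 - B j).
  rewrite (big_nth 0) big_mkord mulr_sumr; apply: eq_bigr => -[j jn] _ /=.
  have [_ _ ->] := inner_rhombus_increments d0 inner (mem j jn) imH (P j jn).
  rewrite tE // BE //; congr (_ * oscillator_action _ _ _).
  by rewrite /B (edge_phaseD (a j)) addrAC subrr add0r.
have nE : n.-1.+1 = n := ltn_predK s1.
have Bn : B n = B 0%N + pi.
  rewrite -[in LHS]nE /B /edge_phase.
  (* One turn adds [2 pi] to the direction of the edge, hence [pi] to its phase. *)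
  have -> : a n.-1 + th n.-1 = a 0%N - th 0%N + pi *+ 2.
    by rewrite addrAC a_last /th; ring.
  by field.
apply: mulr_ge0; first by rewrite mulr_ge0 ?ltW.
apply: oscillator_sum_ge0 => //.
- move=> j jn; have -> : B j.+1 = B j + th j by rewrite (BE j jn) -edge_phaseD.
  by have [/andP[t0 _] _ _ _] := P j jn; rewrite ltrDl.
- have nl : (n.-1 < n)%N by rewrite nE.
  have [_ _ wE _] := P _ nl.
  have n0 : (0 < n)%N by exact: ltnW.
  rewrite -[in LHS]nE /t.
  (* s-holomorphicity across the closing edge replaces the last rhombus by the first; the extra
     phase [pi] then produces the minus sign. *)
  have -> : complex.Re (F (z n.-1) * expi (B n.-1.+1)) =
      complex.Re (F (z 0%N) * expi (B n.-1.+1)).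
    apply: Re_mul_expi_eq d0 wE _.
    apply: holo; first exact: (inner_rh_edge_faces inner (mem _ nl)).1.
    rewrite (face_center_nth_last Gu).
    exact: (inner_rh_edge_faces inner (mem 0%N n0)).2.
  rewrite nE Bn expiD expi_pi.
  by case: (F (z 0%N)) => x y /=; ring.
Qed.

(** Values of [H] are indexed by rhombi; at [u] they agree across each edge shared by consecutive
    rhombi, and so along the whole star by induction from the first neighbor. *)
Lemma H_center_eq (R : realType) (delta : R)
    (G : isoradial_graph delta) (D : discrete_domain G)
    (F : R[i] -> R[i]) (H : R[i] -> R[i] -> R) (u v v' : R[i]) :
  inner_vertex D u -> im_integral D F H -> v \in nbrs G u -> v' \in nbrs G u ->
  H (midpoint u v) u = H (midpoint u v') u.
Proof.
move=> inner [Heq _]; set s := nbrs G u.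
suff h x : x \in s -> H (midpoint u x) u = H (midpoint u s`_0) u.
  by move=> /h -> /h ->.
move=> /(nthP 0)[j + <-]; elim: j => // j IH js.
rewrite -(IH (ltnW js)); apply: (Heq _ _ _ (face_center G u s`_j) _ _).1.
  rewrite (face_center_nthS inner.1 js).
  exact: (inner_rh_edge_faces inner (mem_nth 0 js)).2.
exact: (inner_rh_edge_faces inner (mem_nth 0 (ltnW js))).1.
Qed.

(** * Passage from the full star to the modified star *)

Theorem lemma3p14 (R : realType) (delta eta : R) (G : isoradial_graph delta)
    (D : discrete_domain G) (L : seq (R[i] * R[i]))
    (uint uout w1 w2 zeta : R[i]) (theta : R)
    (F : R[i] -> R[i]) (H : R[i] -> R[i] -> R) :
  0 < delta -> 0 < eta -> rhombus_angles_bounded G eta ->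
  simply_connected_discrete_domain D ->
  white_arc D L -> (uint, uout) \in L -> inner_vertex D uint ->
  w1 = face_center G uout uint -> w2 = face_center G uint uout ->
  zeta = (w1 + w2) / 2%:R -> theta = half_angle uint w1 w2 ->
  s_holomorphic D F -> parallel (F zeta) (sqrtc (w2 - w1))^-1 ->
  im_integral D F H ->
  H zeta w2 = H zeta w1 /\
  forall (wt ut1 ut2 : R[i]) (Hm : R[i] -> R),
    is_rhombus delta uint w1 ut1 wt -> is_rhombus delta uint wt ut2 w2 ->
    half_angle uint w1 wt = theta / 2%:R ->
    half_angle uint wt w2 = theta / 2%:R ->
    Hm uint = H zeta uint ->
    (forall v, v \in nbrs G uint -> v != uout ->
       Hm v = H (midpoint uint v) v) ->
    Hm ut1 = H zeta w1 -> Hm ut2 = H zeta w2 ->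
    0 <= laplacian delta uint (modified_star G uint uout wt ut1 ut2) Hm.
Proof.
move=> d0 _ _ _ [_ _ Lwhite _] uL inner -> -> zetaE thE holo par imH.
have us : uout \in nbrs G uint := (white_half_edge (Lwhite _ _ uL)).2.
have Gu := inner.1.
have [a [P _ _ _]] := star_polar d0 Gu.
have [al P0] : exists al, rhombus_polar delta uint uout
    (face_center G uint uout) (face_center G uout uint) al theta.
  move: (us) => /(nthP 0)[j js vE]; exists (a j).
  by have := P j js; rewrite vE -/(nbr_half_angle G uint uout) thE.
have th0 : 0 < theta < pi / 2 by case: P0.
have zE : zeta = midpoint uint uout.
  by rewrite zetaE /midpoint addrC (rhombus_polar_opp P0).
have := inner_rhombus_increments d0 inner us imH P0.
rewrite -zE /= -(parallel_equal_projections d0 P0 par).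
set p := complex.Re _ => -[e2 e1 eout].
(* With equal projections, both increments from [uint] to the white vertices are [2 delta p^2]. *)
have Hw : H zeta (face_center G uint uout) = H zeta (face_center G uout uint).
  by lra.
split=> // wt ut1 ut2 Hm _ _ h1 h2 Hu Hv Hu1 Hu2.
pose g v := tan (nbr_half_angle G uint v) *
         (H (midpoint uint v) v - H (midpoint uint v) uint).
have half_ge0 v : v \in nbrs G uint -> 0 < nbr_half_angle G uint v < pi / 2.
  by move=> /(nthP 0)[j js <-]; have [] := P j js.
(* The weight is nonnegative, every half-angle being in [(0, pi / 2)]; only the sign of the weighted
   sum of differences remains. *)
rewrite /laplacian; apply: mulr_ge0.
  rewrite invr_ge0; apply: mulr_ge0; first by rewrite divr_ge0 ?sqr_ge0.
  rewrite big_cat !big_cons big_nil /= h1 h2 addr0.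
  have sin2 x : 0 < x < pi / 2 -> 0 <= sin (x *+ 2).
    by move=> x0; apply/ltW/sin_gt0_pi; lra.
  rewrite !addr_ge0 ?sin2 //; try lra.
  rewrite big_filter big_map big_seq_cond; apply: sumr_ge0 => v /andP[vs _].
  exact: sin2 (half_ge0 v vs).
have := star_sum_ge0 d0 inner holo imH; rewrite -/(g _).
rewrite (bigD1_seq uout) ?nbrs_uniq //=.
rewrite big_cat !big_cons big_nil /= h1 h2 Hu1 Hu2 Hu addr0.
rewrite big_filter big_map /=.
(* Away from [uout] the two stars have the same terms, since the value of [H] at [uint] does not
   depend on the rhombus in which it is read. *)
have -> : \sum_(v <- nbrs G uint | v != uout)
   tan (half_angle uint (face_center G v uint) (face_center G uint v)) *
   (Hm v - H zeta uint) = \sum_(v <- nbrs G uint | v != uout) g v.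
  rewrite big_seq_cond [RHS]big_seq_cond; apply: eq_bigr => v /andP[vs vo].
  by rewrite Hv // zE (H_center_eq inner imH us vs).
(* The term of [uout] in the full star becomes [- 4 delta p^2 tan (theta / 2)]; each of the two new
   neighbors contributes half of it. *)
rewrite -zE /nbr_half_angle -thE eout oscillator_action_diag //.
have -> : H zeta (face_center G uint uout) - H zeta uint =
    - (2 * delta * p ^+ 2).
  by lra.
have -> : H zeta (face_center G uout uint) - H zeta uint =
    - (2 * delta * p ^+ 2).
  by lra.
by lra.
Qed.
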